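(* (1) Let $G$ be a group and let $X$ be a $G$-bimodule. Then $\mathsf{T}(X)$ is a Levi monoid with group of units $G$ whose associated $G$-bimodule (of atoms) is $X$. (2) Let $G$ be a group and let $X$ be a $G$-bimodule, with inclusion map $\iota \colon X \rightarrow \mathsf{T}(X)$. Let $S$ be any monoid with group of units $H$, regarded as an $H$-bimodule under left and right multiplication. Let $(\alpha,\beta)$ be a bimodule morphism from $X$ to $S$, where $\alpha \colon G \rightarrow H$ and $\beta \colon X \rightarrow S$. Then there is a unique monoid homomorphism $\theta \colon \mathsf{T}(X) \rightarrow S$ such that $\theta\iota = \beta$ and which agrees with $\alpha$ on $G$ and with $\beta$ on $X$. (3) Every Levi monoid is isomorphic to the tensor monoid of its associated bimodule.
   Context: A length function on a monoid $S$ is a monoid homomorphism $\lambda \colon S \rightarrow \mathbb{N}$ to the additive monoid of natural numbers (including $0$) such that $\lambda^{-1}(0)$ is the group of units of $S$. A monoid $S$ is equidivisible if for all $a,b,c,d\in S$, $ab=cd$ implies that either $a=cu$ and $d=ub$ for some $u\in S$, or $c=av$ and $b=vd$ for some $v\in S$. A Levi monoid is an equidivisible monoid equipped with a length function which contains at least one noninvertible element. An atom of a monoid is a noninvertible element $a$ such that $a=bc$ implies that $b$ or $c$ is invertible. For a group $G$, a $G$-bimodule is a non-empty set $X$ on which $G$ acts on the left and on the right with $(gx)h=g(xh)$ for all $g,h\in G$, $x\in X$. A morphism from a $G$-bimodule $U$ to an $H$-bimodule $V$ is a pair $(\alpha,\beta)$ where $\alpha\colon G\rightarrow H$ is a group homomorphism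 and $\beta\colon U\rightarrow V$ is a function with $\beta(g_1ug_2)=\alpha(g_1)\beta(u)\alpha(g_2)$ for all $g_1,g_2\in G$, $u\in U$. In a Levi monoid with group of units $G$, the set of atoms is closed under left and right multiplication by elements of $G$; this $G$-bimodule is the associated bimodule (of atoms) of the Levi monoid. For a $G$-bimodule $X$, $X\otimes X$ is the quotient of $X\times X$ by the equivalence relation $(x,y)\sim(xg^{-1},gy)$, $g\in G$, with $g(x\otimes y)=gx\otimes y$ and $(x\otimes y)g=x\otimes yg$. More generally $X^{\otimes n}$ ($n\ge 1$) is the analogous $n$-fold tensor product over $G$: $x_1\otimes\cdots\otimes x_n=y_1\otimes\cdots\otimes y_n$ iff there are $g_1,\dots,g_{n-1}\in G$ with $y_1=x_1g_1$, $y_i=g_{i-1}^{-1}x_ig_i$ for $1<i<n$, and $y_n=g_{n-1}^{-1}x_n$ (for $n\ge 2$), while $X^{\otimes 1}=X$. Put $X^{\otimes 0}=G$. The tensor monoid of $X$ is $\mathsf{T}(X)=\bigcup_{n\ge 0}X^{\otimes n}$ (disjoint union), with multiplication given by tensoring (concatenating) sequences, by the left and right actions of $G$ when one factor lies in $G$, and by the multiplication of $G$ when both do. $X=X^{\otimes 1}$ is regarded as a subset of $\mathsf{T}(X)$, and $\iota$ is the inclusion. *)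

(* Defs.v *)
From HB Require Import structures.
From mathcomp Require Import all_boot.
From mathcomp Require Import boolp.
Set Implicit Arguments.
Unset Strict Implicit.
Unset Printing Implicit Defensive.

Local Open Scope group_scope.
Local Open Scope quotient_scope.

(* Monoids and groups are the (possibly infinite) [monoidType] and [groupType]
   of MathComp.  Their carriers have a [choiceType] structure, which is no
   restriction classically: see [gen_choiceMixin] in [boolp]. *)

HB.mixin Record isBimodule (G : groupType) X := {
  lact : G -> X -> X;
  ract : X -> G -> X;
  lact1 : forall x, lact 1 x = x;
  lactM : forall g h x, lact (g * h) x = lact g (lact h x);
  ract1 : forall x, ract x 1 = x;
  ractM : forall x g h, ract x (g * h) = ract (ract x g) h;
  lractA : forall g x h, ract (lact g x) h = lact g (ract x h);
  bimod_nonempty : inhabited X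
}.

#[short(type="bimodType")]
HB.structure Definition Bimodule (G : groupType) :=
  {X of isBimodule G X & Choice X}.

Definition bimod_morphism (G H : groupType) (U : bimodType G) (V : bimodType H)
    (alpha : G -> H) (beta : U -> V) : Prop :=
  monoid_morphism alpha /\
  forall (g1 g2 : G) (u : U),
    beta (ract (lact g1 u) g2) = ract (lact (alpha g1) (beta u)) (alpha g2).

Definition invertible (S : monoidType) (a : S) : Prop :=
  exists b : S, a * b = 1 /\ b * a = 1.

Lemma invertible1 (S : monoidType) : invertible (1 : S).
Proof. by exists 1; rewrite mulg1. Qed.

Lemma invertibleM (S : monoidType) (a b : S) :
  invertible a -> invertible b -> invertible (a * b).
Proof.
move=> [a' [aa' a'a]] [b' [bb' b'b]]; exists (b' * a'); split.
  by rewrite mulgA -(mulgA a) bb' mulg1.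
by rewrite mulgA -(mulgA b') a'a mulg1.
Qed.

Record units (S : monoidType) := Units {
  units_val :> S;
  units_valP : `[< invertible units_val >]
}.

HB.instance Definition _ (S : monoidType) := [isSub for @units_val S].
HB.instance Definition _ (S : monoidType) := [Choice of units S by <:].

Section UnitsGroup.
Variable S : monoidType.
Implicit Types u v : units S.

Lemma units_inv_subproof u :
  exists b : S, units_val u * b = 1 /\ b * units_val u = 1.
Proof. exact: (asboolP _ (units_valP u)). Qed.

Definition units_mul u v : units S :=
  Units (asboolT (invertibleM (units_inv_subproof u) (units_inv_subproof v))).

Definition units_one : units S := Units (asboolT (invertible1 S)).

Lemma units_invP_subproof u :
  invertible (projT1 (cid (units_inv_subproof u))).
Proof. by case: cid => b [ub bu] /=; exists (units_val u). Qed.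

Definition units_inv u : units S := Units (asboolT (units_invP_subproof u)).

Lemma units_mulA : associative units_mul.
Proof. by move=> u v w; apply: val_inj; rewrite /= mulgA. Qed.
Lemma units_mul1 : left_id units_one units_mul.
Proof. by move=> u; apply: val_inj; rewrite /= mul1g. Qed.
Lemma units_mulr1 : right_id units_one units_mul.
Proof. by move=> u; apply: val_inj; rewrite /= mulg1. Qed.
Lemma units_mulV : left_inverse units_one units_inv units_mul.
Proof. by move=> u; apply: val_inj => /=; case: cid => b [ub bu]. Qed.
Lemma units_mulrV : right_inverse units_one units_inv units_mul.
Proof. by move=> u; apply: val_inj => /=; case: cid => b [ub bu]. Qed.

HB.instance Definition _ := isGroup.Build (units S)
  units_mulA units_mul1 units_mulr1 units_mulV units_mulrV.

End UnitsGroup.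

(* A copy of [S] carrying its bimodule structure over its group of units. *)
Definition units_bimod (S : monoidType) : Type := S.
HB.instance Definition _ (S : monoidType) := Choice.on (units_bimod S).

Section UnitsBimod.
Variable S : monoidType.

Definition ub_lact (u : units S) (a : units_bimod S) : units_bimod S :=
  (units_val u * (a : S))%g.
Definition ub_ract (a : units_bimod S) (u : units S) : units_bimod S :=
  ((a : S) * units_val u)%g.

Lemma ub_lact1 a : ub_lact 1 a = a. Proof. exact: mul1g. Qed.
Lemma ub_lactM u v a : ub_lact (u * v) a = ub_lact u (ub_lact v a).
Proof. exact/esym/mulgA. Qed.
Lemma ub_ract1 a : ub_ract a 1 = a. Proof. exact: mulg1. Qed.
Lemma ub_ractM a u v : ub_ract a (u * v) = ub_ract (ub_ract a u) v.
Proof. exact: mulgA. Qed.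
Lemma ub_lractA u a v : ub_ract (ub_lact u a) v = ub_lact u (ub_ract a v).
Proof. exact/esym/mulgA. Qed.

HB.instance Definition _ := isBimodule.Build (units S) (units_bimod S)
  ub_lact1 ub_lactM ub_ract1 ub_ractM ub_lractA (inhabits (1 : S)).

End UnitsBimod.

Definition length_function (S : monoidType) (lambda : S -> nat) : Prop :=
  [/\ lambda 1 = 0%N,
      forall a b : S, lambda (a * b) = (lambda a + lambda b)%N
    & forall a : S, lambda a = 0%N <-> invertible a].

Definition equidivisible (S : monoidType) : Prop :=
  forall a b c d : S, a * b = c * d ->
    (exists u : S, a = c * u /\ d = u * b) \/
    (exists v : S, c = a * v /\ b = v * d).

Definition levi_monoid (S : monoidType) : Prop :=
  [/\ equidivisible S,
      exists lambda : S -> nat, length_function lambda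
    & exists a : S, ~ invertible a].

Definition atom (S : monoidType) (a : S) : Prop :=
  ~ invertible a /\
  forall b c : S, a = b * c -> invertible b \/ invertible c.

(* The hypothesis that [S] is a Levi monoid is used only to see that there is
   an atom, so that the atoms do form a (non-empty) bimodule. *)
Record atoms (S : monoidType) (leviS : levi_monoid S) := Atoms {
  atoms_val :> S;
  atoms_valP : `[< atom atoms_val >]
}.

HB.instance Definition _ (S : monoidType) (leviS : levi_monoid S) :=
  [isSub for @atoms_val S leviS].
HB.instance Definition _ (S : monoidType) (leviS : levi_monoid S) :=
  [Choice of atoms leviS by <:].

Section AtomsBimodule.
Variable S : monoidType.
Implicit Types a b c : S.

Lemma unit_mul_invertible (u : units S) a :
  invertible (units_val u * a) -> invertible a.
Proof.
move=> inv_ua; rewrite -(mul1g a) -[1]/(units_val 1) -(mulVg u) /= -mulgA.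
by apply: invertibleM => //; exact: (units_inv_subproof u^-1).
Qed.

Lemma mul_unit_invertible a (u : units S) :
  invertible (a * units_val u) -> invertible a.
Proof.
move=> inv_au; rewrite -(mulg1 a) -[1]/(units_val 1) -(mulgV u) /= mulgA.
by apply: invertibleM => //; exact: (units_inv_subproof u^-1).
Qed.

Lemma atom_lact (u : units S) a : atom a -> atom (units_val u * a).
Proof.
move=> [ninv_a atom_a]; split=> [/unit_mul_invertible //|b c ua].
have aE : a = (units_val u^-1 * b) * c.
  by rewrite -mulgA -ua mulgA -[units_val u^-1 * _]/(units_val (u^-1 * u)) mulVg mul1g.
by case: (atom_a _ _ aE) => [/unit_mul_invertible|]; [left|right].
Qed.

Lemma atom_ract a (u : units S) : atom a -> atom (a * units_val u).
Proof.
move=> [ninv_a atom_a]; split=> [/mul_unit_invertible //|b c au].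
have aE : a = b * (c * units_val u^-1).
  by rewrite mulgA -au -mulgA -[units_val u * _]/(units_val (u * u^-1))
             mulgV mulg1.
by case: (atom_a _ _ aE) => [|/mul_unit_invertible]; [left|right].
Qed.

Lemma levi_has_atom : levi_monoid S -> exists a : S, atom a.
Proof.
move=> [_ [lambda [lambda1 lambdaM lambda0]] [a0 ninv_a0]].
pose P n := `[< exists2 a : S, ~ invertible a & lambda a = n >].
have exP : exists n, P n by exists (lambda a0); apply/asboolP; exists a0.
case: (ex_minnP exP) => m /asboolP[a ninv_a <-] min_a.
exists a; split=> // b c aE; apply/or_asboolP; rewrite -[_ || _]negbK negb_or.
apply/negP => /andP[/asboolPn ninv_b /asboolPn ninv_c].
have le_ab : (lambda a <= lambda b)%N by apply/min_a/asboolP; exists b.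
suff /ninv_c : invertible c by [].
apply/lambda0/eqP; rewrite -leqn0 -(leq_add2l (lambda b)) addn0.
by rewrite -lambdaM -aE.
Qed.

Variable leviS : levi_monoid S.
Implicit Types (u v : units S) (x : atoms leviS).

Definition atoms_lact u x : atoms leviS :=
  Atoms leviS (asboolT (atom_lact u (asboolW (atoms_valP x)))).
Definition atoms_ract x u : atoms leviS :=
  Atoms leviS (asboolT (atom_ract u (asboolW (atoms_valP x)))).

Lemma atoms_lact1 x : atoms_lact 1 x = x.
Proof. by apply: val_inj; rewrite /= mul1g. Qed.
Lemma atoms_lactM u v x : atoms_lact (u * v) x = atoms_lact u (atoms_lact v x).
Proof. by apply: val_inj; rewrite /= mulgA. Qed.
Lemma atoms_ract1 x : atoms_ract x 1 = x.
Proof. by apply: val_inj; rewrite /= mulg1. Qed.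
Lemma atoms_ractM x u v : atoms_ract x (u * v) = atoms_ract (atoms_ract x u) v.
Proof. by apply: val_inj; rewrite /= mulgA. Qed.
Lemma atoms_lractA u x v :
  atoms_ract (atoms_lact u x) v = atoms_lact u (atoms_ract x v).
Proof. by apply: val_inj; rewrite /= mulgA. Qed.
Lemma atoms_nonempty : inhabited (atoms leviS).
Proof.
by case: (levi_has_atom leviS) => a /asboolT atom_a; split; exists a.
Qed.

HB.instance Definition _ := isBimodule.Build (units S) (atoms leviS)
  atoms_lact1 atoms_lactM atoms_ract1 atoms_ractM atoms_lractA atoms_nonempty.

End AtomsBimodule.

Section TensorMonoid.
Variables (G : groupType) (X : bimodType G).
Implicit Types (g h : G).

(* The equivalence y_1 = x_1 g_1, y_i = g_(i-1)^-1 x_i g_i (1 < i < n),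
   y_n = g_(n-1)^-1 x_n, written uniformly with g_0 = g_n = 1; it is equality
   for n = 1.  Positions in tuples are numbered from 0. *)
Definition tensor_rel n (x y : n.-tuple X) : Prop :=
  exists g : nat -> G, [/\ g 0%N = 1, g n = 1 &
    forall i : 'I_n,
      tnth y i = ract (lact (g i)^-1 (tnth x i)) (g i.+1)].

Definition tensor_relb n : rel (n.-tuple X) :=
  fun x y => `[< tensor_rel x y >].

Lemma tensor_relb_equiv n : equiv_class_of (@tensor_relb n).
Proof.
split=> [x|x y|y x z].
- apply/asboolP; exists (fun=> 1); split=> // i.
  by rewrite invg1 lact1 ract1.
- have sym (a b : n.-tuple X) : tensor_rel a b -> tensor_rel b a.
    move=> [g [g0 gn gE]]; exists (fun i => (g i)^-1).
    rewrite g0 gn invg1; split=> // i.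
    by rewrite gE invgK -lractA -lactM mulgV lact1 -ractM mulgV ract1.
  by apply/asbool_equiv_eq; split; exact: sym.
- move=> /asboolP[g [g0 gn gE]] /asboolP[h [h0 hn hE]].
  apply/asboolP; exists (fun i => g i * h i); rewrite g0 h0 gn hn mulg1.
  by split=> // i; rewrite hE gE -lractA -lactM -ractM invgM.
Qed.

Canonical tensor_equiv n := EquivRelPack (@tensor_relb_equiv n).

Definition tensor_power n : choiceType :=
  if n is m.+1 then {eq_quot (@tensor_equiv m.+1)} else G.

Definition tensor_class n (x : n.+1.-tuple X) : tensor_power n.+1 :=
  \pi_{eq_quot (@tensor_equiv n.+1)} x.

Definition tensor_repr n (x : tensor_power n.+1) : n.+1.-tuple X :=
  repr (x : {eq_quot (@tensor_equiv n.+1)}).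

Lemma tensor_reprK n : cancel (@tensor_repr n) (@tensor_class n).
Proof. by move=> x; rewrite /tensor_class reprK. Qed.

Lemma tensor_classP n (x y : n.+1.-tuple X) :
  tensor_class x = tensor_class y <-> tensor_rel x y.
Proof.
split=> [xy|xy]; last by apply/eqP; rewrite eqmodE; apply/asboolP.
by apply/asboolP; move/eqP: xy; rewrite eqmodE.
Qed.

Lemma tensor_class_repr n (x : n.+1.-tuple X) :
  tensor_rel (tensor_repr (tensor_class x)) x.
Proof. by apply/tensor_classP; rewrite tensor_reprK. Qed.

Definition tuple_lact n g (x : n.+1.-tuple X) : n.+1.-tuple X :=
  [tuple if i == ord0 then lact g (tnth x i) else tnth x i | i < n.+1].

Definition tuple_ract n (x : n.+1.-tuple X) g : n.+1.-tuple X :=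
  [tuple if i == ord_max then ract (tnth x i) g else tnth x i | i < n.+1].

Definition tuple_cat m n (x : m.+1.-tuple X) (y : n.+1.-tuple X) :
  (m + n.+1).+1.-tuple X := cat_tuple x y.

Lemma tnth_tuple_cat m n (x : m.+1.-tuple X) (y : n.+1.-tuple X)
    (i : 'I_(m + n.+1).+1) :
  tnth (tuple_cat x y) i =
  match @split m.+1 n.+1 i with inl j => tnth x j | inr j => tnth y j end.
Proof.
rewrite -[i in LHS](@splitK m.+1 n.+1); case: split => j; rewrite /unsplit.
  exact: (tnth_lshift x y).
exact: (tnth_rshift x y).
Qed.

(* Actions and concatenation on classes are defined on representatives; that
   they do not depend on the latter is [tensor_lactE], [tensor_ractE] and
   [tensor_catE] below. *)
Definition tensor_lact n g (x : tensor_power n.+1) : tensor_power n.+1 :=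
  tensor_class (tuple_lact g (tensor_repr x)).

Definition tensor_ract n (x : tensor_power n.+1) g : tensor_power n.+1 :=
  tensor_class (tuple_ract (tensor_repr x) g).

Definition tensor_cat m n (x : tensor_power m.+1) (y : tensor_power n.+1) :
    tensor_power (m.+1 + n.+1) :=
  tensor_class (tuple_cat (tensor_repr x) (tensor_repr y)).

Definition tensor_monoid : Type := {n : nat & tensor_power n}.

HB.instance Definition _ := Choice.on tensor_monoid.

Definition Tens n (x : tensor_power n) : tensor_monoid :=
  existT (fun n => tensor_power n : Type) n x.

Definition tensor_group (g : G) : tensor_monoid := @Tens 0 g.

Definition tensor_iota (x : X) : tensor_monoid :=
  @Tens 1 (tensor_class [tuple x]).

Definition tensor_one : tensor_monoid := tensor_group 1.

Definition tensor_mul (s t : tensor_monoid) : tensor_monoid :=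
  let: existT m x := s in let: existT n y := t in
  match m, n return tensor_power m -> tensor_power n -> tensor_monoid with
  | 0, 0 => fun g h => @Tens 0 ((g : G) * (h : G))%g
  | 0, n.+1 => fun g y => @Tens n.+1 (tensor_lact g y)
  | m.+1, 0 => fun x h => @Tens m.+1 (tensor_ract x h)
  | m.+1, n.+1 => fun x y => @Tens (m.+1 + n.+1) (tensor_cat x y)
  end x y.

Lemma tensor_lactE n g (x : n.+1.-tuple X) :
  tensor_lact g (tensor_class x) = tensor_class (tuple_lact g x).
Proof.
apply/tensor_classP; case: (tensor_class_repr x) => a [a0 an aE].
exists a; split=> // i; rewrite !tnth_mktuple aE.
case: eqP => [->|//]; by rewrite a0 invg1 !lact1 lractA.
Qed.

Lemma tensor_ractE n (x : n.+1.-tuple X) g :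
  tensor_ract (tensor_class x) g = tensor_class (tuple_ract x g).
Proof.
apply/tensor_classP; case: (tensor_class_repr x) => a [a0 an aE].
exists a; split=> // i; rewrite !tnth_mktuple aE.
case: eqP => [->|//]; by rewrite /= an !ract1 lractA.
Qed.

Lemma tensor_catE m n (x : m.+1.-tuple X) (y : n.+1.-tuple X) :
  tensor_cat (tensor_class x) (tensor_class y) =
  tensor_class (tuple_cat x y).
Proof.
apply/tensor_classP.
case: (tensor_class_repr x) => a [a0 am aE].
case: (tensor_class_repr y) => b [b0 bn bE].
exists (fun i => if (i <= m)%N then a i else b (i - m.+1)%N).
split=> //.
  by rewrite -addSn leqNgt leq_addr /= addKn.
move=> i; rewrite !tnth_tuple_cat.
case: (@splitP m.+1 n.+1 i) => j ->.
  rewrite aE -ltnS ltn_ord; case: ltnP => // le_mj.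
  have -> : j.+1 = m.+1 by apply/eqP; rewrite eqn_leq ltn_ord.
  by rewrite am subnn b0.
rewrite bE.
have -> : (m.+1 + j <= m)%N = false by rewrite leqNgt ltnS leq_addr.
have -> : (m.+1 + j < m)%N = false.
  by rewrite ltnNge (leq_trans _ (leq_addr _ _)).
by rewrite -addnS !addKn.
Qed.

Lemma Tens_eq m n (x : m.+1.-tuple X) (y : n.+1.-tuple X) :
  x = y :> seq X -> Tens (tensor_class x) = Tens (tensor_class y).
Proof.
move=> xy; have mn : m = n by apply: succn_inj; rewrite -(size_tuple x) xy size_tuple.
by case: n / mn in y xy *; congr (Tens (tensor_class _)); apply: val_inj.
Qed.

Lemma tensor_mul1 : left_id tensor_one tensor_mul.
Proof.
move=> [[|n] x]; congr (Tens _); first exact: mul1g.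
rewrite -{2}[x]tensor_reprK /tensor_lact; congr (tensor_class _).
by apply: eq_from_tnth => i; rewrite tnth_mktuple lact1 if_same.
Qed.

Lemma tensor_mulr1 : right_id tensor_one tensor_mul.
Proof.
move=> [[|n] x]; congr (Tens _); first exact: mulg1.
rewrite -{2}[x]tensor_reprK /tensor_ract; congr (tensor_class _).
by apply: eq_from_tnth => i; rewrite tnth_mktuple ract1 if_same.
Qed.

Lemma tuple_lactM n g h (x : n.+1.-tuple X) :
  tuple_lact (g * h) x = tuple_lact g (tuple_lact h x).
Proof.
by apply: eq_from_tnth => i; rewrite !tnth_mktuple; case: ifP; rewrite ?lactM.
Qed.

Lemma tuple_ractM n (x : n.+1.-tuple X) g h :
  tuple_ract x (g * h) = tuple_ract (tuple_ract x g) h.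
Proof.
by apply: eq_from_tnth => i; rewrite !tnth_mktuple; case: ifP; rewrite ?ractM.
Qed.

Lemma tuple_lractA n g (x : n.+1.-tuple X) h :
  tuple_ract (tuple_lact g x) h = tuple_lact g (tuple_ract x h).
Proof.
apply: eq_from_tnth => i; rewrite !tnth_mktuple.
by do 2!case: ifP => _; rewrite ?lractA.
Qed.

Lemma tuple_lact_cat m n g (x : m.+1.-tuple X) (y : n.+1.-tuple X) :
  tuple_lact g (tuple_cat x y) = tuple_cat (tuple_lact g x) y.
Proof.
apply: eq_from_tnth => i; rewrite tnth_mktuple !tnth_tuple_cat.
case: (@splitP m.+1 n.+1 i) => j iE; first by rewrite tnth_mktuple -val_eqE /= iE.
by rewrite -val_eqE /= iE.
Qed.

Lemma tuple_cat_ract m n (x : m.+1.-tuple X) (y : n.+1.-tuple X) g :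
  tuple_ract (tuple_cat x y) g = tuple_cat x (tuple_ract y g).
Proof.
apply: eq_from_tnth => i; rewrite tnth_mktuple !tnth_tuple_cat.
case: (@splitP m.+1 n.+1 i) => j iE; rewrite -val_eqE /= iE.
  by rewrite ltn_eqF // (leq_trans (ltn_ord j)) // -addSnnS leq_addr.
by rewrite tnth_mktuple -addSnnS eqn_add2l -val_eqE.
Qed.

Lemma tuple_cat_mid m n (x : m.+1.-tuple X) g (y : n.+1.-tuple X) :
  tensor_rel (tuple_cat (tuple_ract x g) y) (tuple_cat x (tuple_lact g y)).
Proof.
exists (fun i => if i == m.+1 then g^-1 else 1); split=> //.
  by rewrite eqSS -{2}[m]addn0 eqn_add2l.
move=> i; rewrite !tnth_tuple_cat.
case: (@splitP m.+1 n.+1 i) => j ->; rewrite tnth_mktuple -val_eqE /=.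
  rewrite ltn_eqF ?ltn_ord // invg1 lact1 eqSS.
  by case: eqP => _; rewrite ?ract1 // -ractM mulgV ract1.
have -> : (m.+1 + j == m.+1) = (j == 0%N :> nat).
  by rewrite -[X in _ == X]addn0 eqn_add2l.
have -> : ((m.+1 + j).+1 == m.+1) = false.
  by rewrite gtn_eqF // ltnS leq_addr.
rewrite ract1.
by case: eqP => _; rewrite ?invgK ?invg1 ?lact1.
Qed.

Lemma tuple_catA l m n (x : l.+1.-tuple X) (y : m.+1.-tuple X)
    (z : n.+1.-tuple X) :
  tuple_cat x (tuple_cat y z) = tuple_cat (tuple_cat x y) z :> seq X.
Proof. exact: catA. Qed.

Lemma tensor_classI n (x : tensor_power n.+1) :
  exists x', x = tensor_class x'.
Proof. by exists (tensor_repr x); rewrite tensor_reprK. Qed.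

Lemma tensor_mulA : associative tensor_mul.
Proof.
move=> [[|l] x] [[|m] y] [[|n] z].
- by congr Tens; exact: mulgA.
- have [z' ->] := tensor_classI z.
  by rewrite /= !tensor_lactE -tuple_lactM.
- have [y' ->] := tensor_classI y.
  by rewrite /= !(tensor_lactE, tensor_ractE) -tuple_lractA.
- have [y' ->] := tensor_classI y; have [z' ->] := tensor_classI z.
  by rewrite /= !(tensor_lactE, tensor_catE) tuple_lact_cat.
- have [x' ->] := tensor_classI x.
  by rewrite /= !tensor_ractE -tuple_ractM.
- have [x' ->] := tensor_classI x; have [z' ->] := tensor_classI z.
  rewrite /= !(tensor_lactE, tensor_ractE, tensor_catE).
  congr Tens; exact/esym/tensor_classP/tuple_cat_mid.
- have [x' ->] := tensor_classI x; have [y' ->] := tensor_classI y.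
  by rewrite /= !(tensor_ractE, tensor_catE) tuple_cat_ract.
- have [x' ->] := tensor_classI x; have [y' ->] := tensor_classI y.
  have [z' ->] := tensor_classI z.
  rewrite /= !tensor_catE; apply: Tens_eq; exact: tuple_catA.
Qed.

HB.instance Definition _ := isMonoid.Build tensor_monoid
  tensor_mulA tensor_mul1 tensor_mulr1.

End TensorMonoid.

(* Main.v *)
(* Every element of T(X) other than those of G has the form x t with x in X, and
   x t = y u in T(X) exactly when y = x g and t = g u for some g in G. Peeling
   off first factors this way gives equidivisibility of T(X); the degree is a
   length function.  A Levi monoid S is generated by its units and atoms, by
   induction on length, so the canonical map T(atoms) -> S is onto; it is
   injective because equidivisibility of S forces the same first-factor
   comparison on products of atoms. *)
Require Import Defs.
From mathcomp Require Import all_boot.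
From mathcomp Require Import boolp.
Set Implicit Arguments.
Unset Strict Implicit.
Unset Printing Implicit Defensive.

Local Open Scope group_scope.

(** * Structure of T(X): degree, units, equidivisibility, atoms *)

Section TensorMonoidTheory.
Variables (G : groupType) (X : bimodType G).
Implicit Types (g h : G) (x y : X) (t : tensor_monoid X).

(** The index type [nat] has decidable equality, so equal dependent pairs over one degree have equal
    components. *)
Lemma Tens_inj n : injective (@Tens G X n).
Proof. by move=> t u /eqP; rewrite /Tens eq_Tagged => /eqP. Qed.

Lemma tensor_groupM : {morph tensor_group X : g h / g * h}.
Proof. by []. Qed.

Lemma tensor_groupK g t : tensor_group X g * (tensor_group X g^-1 * t) = t.
Proof. by rewrite mulgA -tensor_groupM mulgV mul1g. Qed.

Lemma tensor_groupVK g t : tensor_group X g^-1 * (tensor_group X g * t) = t.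
Proof. by rewrite mulgA -tensor_groupM mulVg mul1g. Qed.

Lemma tagM t u : tag (t * u) = (tag t + tag u)%N.
Proof. by case: t u => [[|m] x] [[|n] y]; rewrite /= ?addn0. Qed.

Lemma tag_eq0 t : tag t = 0%N -> exists g, t = tensor_group X g.
Proof. by case: t => [[|n] g] //= _; exists g. Qed.

Lemma tuple_lact_seq n g (s : n.+1.-tuple X) :
  tuple_lact g s = lact g (thead s) :: behead s :> seq X.
Proof.
case/tupleP: s => x s; rewrite theadE.
apply: (@eq_from_nth _ x) => [|i]; first by rewrite size_tuple /= size_tuple.
rewrite size_tuple => lt_in.
rewrite -[i]/(nat_of_ord (Ordinal lt_in)) -tnth_nth tnth_mktuple.
rewrite (tnth_nth x) -val_eqE /=.
by case: i lt_in.
Qed.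

Lemma tensor_iota_mul_class n x (s : n.+1.-tuple X) :
  tensor_iota x * Tens (tensor_class s) = Tens (tensor_class [tuple of x :: s]).
Proof.
rewrite [LHS]/(Tens _) tensor_catE; exact: Tens_eq.
Qed.

Lemma tensor_iota_mul_group x g :
  tensor_iota x * tensor_group X g = tensor_iota (ract x g).
Proof.
rewrite [LHS]/(Tens _) tensor_ractE; congr (Tens (tensor_class _)).
by apply: eq_from_tnth => i; rewrite tnth_mktuple !ord1.
Qed.

Lemma tensor_group_mul_class n g (s : n.+1.-tuple X) :
  tensor_group X g * Tens (tensor_class s) = Tens (tensor_class (tuple_lact g s)).
Proof. by rewrite [LHS]/(Tens _) tensor_lactE. Qed.

Lemma tensor_group_mul_iota g x :
  tensor_group X g * tensor_iota x = tensor_iota (lact g x).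
Proof.
by rewrite tensor_group_mul_class; apply: Tens_eq; rewrite tuple_lact_seq.
Qed.

(** Starting in degree 0 suffices, as [tensor_iota x] is [tensor_iota x * 1]; higher degrees come
    from consing onto a representative tuple. *)
Lemma tensor_ind (P : tensor_monoid X -> Prop) :
    (forall g, P (tensor_group X g)) ->
    (forall x t, P t -> P (tensor_iota x * t)) ->
  forall t, P t.
Proof.
move=> Pgroup Piota [[|n] t]; first exact: Pgroup.
have [s ->] := tensor_classI t; rewrite -/(Tens _).
elim: n s {t} => [|n IHn] s; case/tupleP: s => x s.
  have -> : Tens (tensor_class [tuple of x :: s]) = tensor_iota x * 1.
    by rewrite mulg1 (tuple0 s).
  exact/Piota/Pgroup.
by rewrite -tensor_iota_mul_class; exact: Piota.
Qed.

Lemma tensor_rel1 x y : tensor_rel [tuple x] [tuple y] -> x = y.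
Proof.
case=> g [g0 g1 /(_ ord0)]; rewrite !tnth0 /= g0 g1.
by rewrite invg1 lact1 ract1.
Qed.

Lemma tensor_iota_inj : injective (@tensor_iota G X).
Proof. by move=> x y /Tens_inj/tensor_classP/tensor_rel1. Qed.

(** Cancellation of first factors up to [G]: when [t] has positive degree, [g] is the first interior
    connecting element of the tensor relation. *)
Lemma tensor_iota_mulI x y t u :
    tensor_iota x * t = tensor_iota y * u ->
  exists g, y = ract x g /\ t = tensor_group X g * u.
Proof.
move=> xt_yu; have : tag t = tag u.
  by have := congr1 tag xt_yu; rewrite !tagM => /addnI.
case: t u xt_yu => [[|n] t] [m u] /= xt_yu nm.
  case: m / nm u xt_yu => h; rewrite -!/(tensor_group X _) !tensor_iota_mul_group.
  move/tensor_iota_inj => xt_yh; exists (t * h^-1); split.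
    by rewrite ractM xt_yh -ractM mulgV ract1.
  by rewrite -tensor_groupM -mulgA mulVg mulg1.
case: m / nm u xt_yu => u; have [s ->] := tensor_classI t.
have [r ->] := tensor_classI u; rewrite -!/(Tens _) !tensor_iota_mul_class.
move=> /Tens_inj/tensor_classP[g [g0 gn gE]]; exists (g 1%N); split.
  by have := gE ord0; rewrite !tnth0 g0 invg1 lact1.
rewrite tensor_group_mul_class; congr Tens; apply/tensor_classP.
(* The connecting sequence is shifted by one; its new initial entry is reset to 1 because [g 1] is
   already absorbed by the action on [r]. *)
exists (fun i => if i is 0 then 1 else g i.+1); split=> // i.
have := gE (lift ord0 i); rewrite !tnthS tnth_mktuple => ->.
have [->|] := eqVneq i ord0; last by case: i => [[|i] ?].
by rewrite /= invg1 lact1 -lractA -lactM mulgV lact1.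
Qed.

(** Degree is additive, so a factor of 1 has degree 0. *)
Lemma tensor_invertibleP t : tag t = 0%N <-> invertible t.
Proof.
split=> [/tag_eq0[g ->]|[u [/(congr1 tag)]]].
  exists (tensor_group X g^-1).
  by rewrite -!tensor_groupM mulgV mulVg.
by rewrite tagM => /eqP; rewrite addn_eq0 => /andP[/eqP].
Qed.

Lemma tensor_equidivisible : equidivisible (tensor_monoid X).
Proof.
move=> a; elim/tensor_ind: a => [g|x a IHa] b c d.
  move=> gb_cd; right; exists (tensor_group X g^-1 * c).
  by rewrite tensor_groupK -mulgA -gb_cd tensor_groupVK.
elim/tensor_ind: c => [g xab_gd|y c _].
  left; exists (tensor_group X g^-1 * (tensor_iota x * a)).
  by rewrite tensor_groupK -mulgA xab_gd tensor_groupVK.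
(* The unit relating the first factors is absorbed into [c], so the induction hypothesis has to hold
   for every [c]. *)
rewrite -!mulgA => /tensor_iota_mulI[g [-> ]].
rewrite mulgA -tensor_iota_mul_group => /IHa[] [u [aE ->]].
  by left; exists u; rewrite aE !mulgA.
by right; exists u; rewrite -!mulgA aE.
Qed.

Lemma tensor_levi : levi_monoid (tensor_monoid X).
Proof.
split; first exact: tensor_equidivisible.
  exists tag; split=> //; [exact: tagM | exact: tensor_invertibleP].
by have [x] := @bimod_nonempty G X; exists (tensor_iota x) => /tensor_invertibleP.
Qed.

(** Peeling the first factor off an atom must leave a unit, which that factor absorbs; conversely,
    in degree 1 additivity puts one of two factors in degree 0. *)
Lemma atom_tensorP t : atom t <-> exists x, t = tensor_iota x.
Proof.
split=> [|[x ->]].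
  elim/tensor_ind: t => [g [[]]|x t _ [_ /(_ _ _ erefl)[]/tensor_invertibleP]] //.
    exact/tensor_invertibleP.
  by move=> /tag_eq0[g ->]; exists (ract x g); rewrite tensor_iota_mul_group.
split=> [/tensor_invertibleP //|b c /(congr1 tag)]; rewrite tagM /=.
case tb: (tag b) => [|n]; first by left; apply/tensor_invertibleP.
by case tc: (tag c) => [|m]; [right; apply/tensor_invertibleP|rewrite addnS].
Qed.

End TensorMonoidTheory.

(** * Universal property of the tensor monoid *)

Section UniversalProperty.
Variables (G : groupType) (X : bimodType G) (S : monoidType).
Variables (alpha : G -> units S) (beta : X -> units_bimod S).
Hypothesis ab : bimod_morphism alpha beta.
Implicit Types (g h : G) (x : X) (t : tensor_monoid X) (s : seq X).

Let alpha1 : alpha 1 = 1. Proof. by case: ab => -[]. Qed.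
Let alphaM : {morph alpha : g h / g * h}. Proof. by case: ab => -[]. Qed.

Lemma bimod_morphism_lact g x :
  beta (lact g x) = units_val (alpha g) * (beta x : S).
Proof.
have := ab.2 g 1 x; rewrite ract1 alpha1 => ->.
exact: mulg1.
Qed.

Lemma bimod_morphism_ract x g :
  beta (ract x g) = (beta x : S) * units_val (alpha g).
Proof.
have := ab.2 1 g x; rewrite lact1 alpha1 => ->.
by congr (_ * _); exact: mul1g.
Qed.

Let prodb s : S := foldr (fun x a => (beta x : S) * a) 1 s.

(** The connecting elements telescope. The end values [g 0] and [g n] are left free for the
    induction; both are 1 for equivalent tuples, so [prodb] is constant on classes. *)
Lemma prodb_rel n (s r : n.-tuple X) (g : nat -> G) :
    (forall i : 'I_n, tnth r i = ract (lact (g i)^-1 (tnth s i)) (g i.+1)) ->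
  units_val (alpha (g 0%N)) * prodb r = prodb s * units_val (alpha (g n)).
Proof.
elim: n s r g => [|n IHn] s r g.
  by rewrite (tuple0 s) (tuple0 r) mulg1 mul1g.
case/tupleP: s => x s; case/tupleP: r => y r rE /=.
have /= {}IHn := IHn s r (fun i => g i.+1).
rewrite -mulgA -IHn => [|i]; last first.
  by have := rE (lift ord0 i); rewrite !tnthS.
have -> : y = ract (lact (g 0%N)^-1 x) (g 1%N) by exact: (rE ord0).
rewrite bimod_morphism_ract bimod_morphism_lact !mulgA.
by rewrite -[units_val _ * units_val _]/(units_val (_ * _)) -alphaM mulgV alpha1 mul1g.
Qed.

(** Evaluated on a chosen representative; [tensor_lift_class] gives independence of the choice. *)
Definition tensor_lift t : S :=
  match t with
  | existT 0 g => units_val (alpha g)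
  | existT n.+1 u => prodb (tensor_repr u)
  end.

Lemma tensor_lift_group g : tensor_lift (tensor_group X g) = units_val (alpha g).
Proof. by []. Qed.

Lemma tensor_lift_class n (s : n.+1.-tuple X) :
  tensor_lift (Tens (tensor_class s)) = prodb s.
Proof.
have [g [g0 gn gE]] := tensor_class_repr s.
by have := prodb_rel gE; rewrite g0 gn alpha1 mul1g mulg1.
Qed.

Lemma tensor_lift_iota x : tensor_lift (tensor_iota x) = beta x.
Proof. by rewrite tensor_lift_class /= mulg1. Qed.

Lemma tensor_liftM_group g t :
  tensor_lift (tensor_group X g * t) = units_val (alpha g) * tensor_lift t.
Proof.
case: t => [[|n] t]; first by rewrite -tensor_groupM /= alphaM.
have [s ->] := tensor_classI t; rewrite -/(Tens _) tensor_group_mul_class.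
rewrite !tensor_lift_class tuple_lact_seq; case/tupleP: s => x s.
by rewrite theadE /= bimod_morphism_lact mulgA.
Qed.

Lemma tensor_liftM_iota x t :
  tensor_lift (tensor_iota x * t) = (beta x : S) * tensor_lift t.
Proof.
case: t => [[|n] t].
  by rewrite tensor_iota_mul_group tensor_lift_iota bimod_morphism_ract.
have [s ->] := tensor_classI t; rewrite -/(Tens _) tensor_iota_mul_class.
by rewrite !tensor_lift_class.
Qed.

Lemma tensor_lift_morphism : monoid_morphism tensor_lift.
Proof.
split=> [|t u]; first by rewrite tensor_lift_group alpha1.
elim/tensor_ind: t => [g|x t IHt]; first exact: tensor_liftM_group.
by rewrite -mulgA !tensor_liftM_iota IHt mulgA.
Qed.

Lemma tensor_lift_unique (theta : tensor_monoid X -> S) :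
    monoid_morphism theta -> theta \o @tensor_iota G X = beta ->
    (forall g, theta (tensor_group X g) = units_val (alpha g)) ->
  tensor_lift = theta.
Proof.
move=> [_ thetaM] theta_beta theta_alpha; apply: funext => t.
elim/tensor_ind: t => [g|x t IHt]; first by rewrite theta_alpha.
by rewrite tensor_liftM_iota thetaM IHt -theta_beta.
Qed.

End UniversalProperty.

Lemma inj_surj_bij (A B : Type) (f : A -> B) :
  injective f -> (forall b, exists a, f a = b) -> bijective f.
Proof.
move=> f_inj f_surj; exists (fun b => projT1 (cid (f_surj b))) => [a|b].
  by case: cid => a' /= /f_inj.
by case: cid.
Qed.

(** * Levi monoids as tensor monoids of their atoms *)

Section LeviTensor.
Variables (S : monoidType) (leviS : levi_monoid S).
Implicit Types (a b : S) (x y : atoms leviS) (t : tensor_monoid (atoms leviS)).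

(** A sum of two lengths vanishes only if both do, and length 0 means invertible. *)
Lemma levi_invertibleMl a b : invertible (a * b) -> invertible a.
Proof.
have [_ [lambda [_ lambdaM lambda0]] _] := leviS.
by move=> /lambda0/eqP; rewrite lambdaM addn_eq0 => /andP[/eqP/lambda0].
Qed.

Lemma invertible_units a : invertible a -> exists u : units S, units_val u = a.
Proof. by move=> a_inv; exists (Units (asboolT a_inv)). Qed.

Lemma atoms_bimod_morphism :
  bimod_morphism (@id (units S)) (fun x => atoms_val x : units_bimod S).
Proof. by []. Qed.

Let theta := tensor_lift (@id (units S)) (fun x => atoms_val x : units_bimod S).
Let thetaG := tensor_liftM_group atoms_bimod_morphism.
Let thetaX := tensor_liftM_iota atoms_bimod_morphism.

Lemma atoms_not_invertible x : ~ invertible (atoms_val x).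
Proof. by have /asboolW[] := atoms_valP x. Qed.

(* Of two atoms beginning equal products, equidivisibility makes one a right
   multiple of the other, necessarily by a unit, which can be moved across the
   tensor sign. *)
Lemma levi_lift_inj : injective theta.
Proof.
have [equiS _ _] := leviS.
have atomM x y a : atoms_val x = atoms_val y * a ->
    exists u : units S, units_val u = a /\ x = ract y u.
  move=> x_ya; have /asboolW[_ /(_ _ _ x_ya)[/atoms_not_invertible //|]] :=
    atoms_valP x.
  move=> /invertible_units[u uE]; exists u; split=> //.
  by apply: val_inj; rewrite /= uE.
move=> t; elim/tensor_ind: t => [g|x t IHt] u.
  elim/tensor_ind: u => [h /val_inj -> //|y u _].
  rewrite /theta thetaX => gyu.
  (* A unit cannot equal a product starting with an atom. *)
  have /levi_invertibleMl/atoms_not_invertible [] :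
    invertible (atoms_val y * theta u).
  by rewrite -[_ * _]gyu; exact: units_inv_subproof.
elim/tensor_ind: u => [h|y u _]; rewrite /theta !thetaX.
  move=> xth; have /levi_invertibleMl/atoms_not_invertible [] :
    invertible (atoms_val x * theta t).
  by rewrite [_ * _]xth; exact: units_inv_subproof.
move=> /equiS[] [_ [/atomM[g [<- ->]]]]; rewrite -thetaG.
  (* The unit is moved to the other side, so that [IHt] applies to two tensors with equal image. *)
  move=> uE; have /IHt -> : theta t = theta (tensor_group _ g^-1 * u).
    rewrite /theta thetaG uE thetaG mulgA.
    by rewrite -[units_val _ * _]/(units_val (g^-1 * g)) mulVg mul1g.
  by rewrite -tensor_iota_mul_group -mulgA tensor_groupK.
by move=> /IHt ->; rewrite mulgA tensor_iota_mul_group.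
Qed.

(** Strong induction on length: a noninvertible non-atom splits into two noninvertible factors, each
    strictly shorter because the other has positive length. *)
Lemma levi_lift_surj a : exists t, theta t = a.
Proof.
have [_ [lambda [_ lambdaM lambda0]] _] := leviS.
have [n] := ubnP (lambda a); elim: n a => // n IHn a; rewrite ltnS => le_an.
have [/invertible_units[u <-]|ninv_a] := pselect (invertible a).
  by exists (tensor_group _ u).
have [atom_a|] := pselect (atom a).
  exists (tensor_iota (Atoms leviS (asboolT atom_a))).
  exact: (tensor_lift_iota atoms_bimod_morphism).
have lambda_gt0 b : ~ invertible b -> (0 < lambda b)%N.
  by move=> ninv_b; rewrite lt0n; apply/eqP => /lambda0.
move=> natom_a.
have [b [c [aE [ninv_b ninv_c]]]] :
    exists b c, a = b * c /\ ~ invertible b /\ ~ invertible c.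
  apply: contrapT => noBC; apply: natom_a; split=> // b c aE.
  apply: contrapT => /not_orP ninv; apply: noBC; exists b, c; split=> //.
have := le_an; rewrite aE lambdaM => le_bcn.
have [|t <-] := IHn b.
  by apply: leq_trans le_bcn; rewrite -addn1 leq_add2l lambda_gt0.
have [|u <-] := IHn c.
  by apply: leq_trans le_bcn; rewrite -add1n leq_add2r lambda_gt0.
by exists (t * u); exact: (tensor_lift_morphism atoms_bimod_morphism).2.
Qed.

(** The inverse of the bijective morphism [theta] is again a morphism. *)
Lemma levi_tensor_iso :
  exists phi : S -> tensor_monoid (atoms leviS),
    monoid_morphism phi /\ bijective phi.
Proof.
have [theta1 thetaM] : monoid_morphism theta.
  exact: tensor_lift_morphism atoms_bimod_morphism.
have [phi thetaK phiK] := inj_surj_bij levi_lift_inj levi_lift_surj.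
exists phi; split; last by exists theta.
split=> [|a b]; first by rewrite -[RHS]thetaK theta1.
by rewrite -[RHS]thetaK thetaM !phiK.
Qed.

End LeviTensor.

Theorem theorem2p16 :
  (forall (G : groupType) (X : bimodType G),
     exists (leviT : levi_monoid (tensor_monoid X))
            (alpha : G -> units (tensor_monoid X)) (beta : X -> atoms leviT),
       [/\ bimod_morphism alpha beta,
           bijective alpha,
           bijective beta,
           (forall g : G, units_val (alpha g) = tensor_group X g)
         & forall x : X, atoms_val (beta x) = tensor_iota x])
  /\
  (forall (G : groupType) (X : bimodType G) (S : monoidType)
          (alpha : G -> units S) (beta : X -> units_bimod S),
     bimod_morphism alpha beta ->
     exists! theta : tensor_monoid X -> S,
       [/\ monoid_morphism theta,
           theta \o @tensor_iota G X = beta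
         & forall g : G, theta (tensor_group X g) = units_val (alpha g)])
  /\
  (forall (S : monoidType) (leviS : levi_monoid S),
     exists phi : S -> tensor_monoid (atoms leviS),
       monoid_morphism phi /\ bijective phi).
Proof.
split; last split.
- move=> G X; exists (tensor_levi X).
  have unitG g : invertible (tensor_group X g) by exact/tensor_invertibleP.
  have atomX (x : X) : atom (tensor_iota x) by apply/atom_tensorP; exists x.
  (* The two maps are the inclusions of [G] and [X], corestricted to units and to atoms. *)
  exists (fun g => Units (asboolT (unitG g))).
  exists (fun x => Atoms (tensor_levi X) (asboolT (atomX x))).
  split=> //.
  + split=> [|g h x].
      by split=> [|g h]; apply: val_inj.
    apply: val_inj => /=.
    by rewrite tensor_group_mul_iota tensor_iota_mul_group.
  + apply: inj_surj_bij => [g h /(congr1 val)/Tens_inj//|u].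
    (* Units have degree 0, hence come from [G]. *)
    have /tensor_invertibleP/tag_eq0[g uE] := units_inv_subproof u.
    by exists g; apply: val_inj.
  + apply: inj_surj_bij => [x y /(congr1 val)/tensor_iota_inj//|t].
    have /asboolW/atom_tensorP[x tE] := atoms_valP t.
    by exists x; apply: val_inj.
- move=> G X S alpha beta ab; exists (tensor_lift alpha beta).
  split=> [|theta [thetaM theta_beta theta_alpha]].
    split=> //; first exact: tensor_lift_morphism.
    by apply: funext => x; exact: tensor_lift_iota.
  exact: tensor_lift_unique.
- exact: levi_tensor_iso.
Qed.
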